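(* For every positive integer $M$, \[ \sum_{i=0}^{M} q^{T_i}\,(-cq;q)_i\,{M\brack i}_q=(-q;q)_M\sum_{k=0}^{M}\frac{c^k q^{2T_k}}{(q^2;q^2)_k}\,(q^{M-k+1};q)_k . \]
   Context: $q$ and $c$ are indeterminates (the identity is one of polynomials in $q,c$). $T_k=k(k+1)/2$. For $n\ge 0$, $(x;q)_n=\prod_{j=0}^{n-1}(1-xq^j)$. For integers $0\le m\le n$, ${n\brack m}_q=\frac{(q;q)_n}{(q;q)_m(q;q)_{n-m}}$ is the Gaussian binomial coefficient, and ${n\brack m}_q=0$ if $m<0$ or $m>n$. *)

(* Defs.v *)
From HB Require Import structures.
From mathcomp Require Import all_boot all_order all_algebra.

Set Implicit Arguments.
Unset Strict Implicit.
Unset Printing Implicit Defensive.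

Import GRing.Theory.
Local Open Scope ring_scope.

Definition triangular (k : nat) : nat := ((k * k.+1) %/ 2)%N.

Definition qpoch (R : comNzRingType) (x q : R) (n : nat) : R :=
  \prod_(j < n) (1 - x * q ^+ j).

Definition qbinom (F : fieldType) (q : F) (n m : nat) : F :=
  if (m <= n)%N then qpoch q q n / (qpoch q q m * qpoch q q (n - m)) else 0.

(* The field of rational functions in the two indeterminates q (the inner
   polynomial variable) and c (the outer one). Z[q,c] embeds in it, and in it
   q is not a root of unity, so no denominator q-Pochhammer symbol vanishes. *)
Definition ratfun_qc : fieldType := {fraction {poly {poly int}}}.

Definition q_indet : ratfun_qc := tofrac (('X : {poly int})%:P).
Definition c_indet : ratfun_qc := tofrac ('X : {poly {poly int}}).

(* Main.v *)
Require Import Defs.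
From mathcomp Require Import all_boot all_order all_algebra.
From mathcomp Require Import ring.

Import GRing.Theory.
Local Open Scope ring_scope.

(** Expand [(-cq;q)_i] by the q-binomial theorem of Gauss and compare the
    coefficients of [c^k]. On the left, the trinomial revision
    [[M,k+j] [k+j,k] = [M,k] [M-k,j]] and [T_(k+j) = T_k + T_j + k j] turn the sum
    over [i = k + j] into [q^(2 T_k) [M,k]] times [sum_j q^(T_j) [M-k,j] (q^k)^j],
    which is [(-q^(k+1);q)_(M-k)] by Gauss again. On the right,
    [(q^2;q^2)_k = (q;q)_k (-q;q)_k] gives the same product. *)

Lemma triangularD k j :
  triangular (k + j) = (triangular k + triangular j + k * j)%N.
Proof.
have T2 n : (triangular n * 2 = n * n.+1)%N.
  by rewrite /triangular divnK // dvdn2 oddM oddS andbN.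
by apply/eqP; rewrite -(eqn_pmul2r (isT : 0 < 2)%N) !mulnDl !T2; apply/eqP; ring.
Qed.

Lemma triangularS k : triangular k.+1 = (triangular k + k.+1)%N.
Proof. by rewrite -addn1 triangularD muln1 -addnA (addnC k). Qed.

Section QPochhammer.
Context {R : comNzRingType}.
Implicit Types x q : R.

Lemma qpoch0 x q : qpoch x q 0 = 1.
Proof. exact: big_ord0. Qed.

Lemma qpochS x q n : qpoch x q n.+1 = qpoch x q n * (1 - x * q ^+ n).
Proof. exact: big_ord_recr. Qed.

Lemma qpochD x q m n :
  qpoch x q (m + n) = qpoch x q m * qpoch (x * q ^+ m) q n.
Proof.
elim: n => [|n IHn]; first by rewrite addn0 qpoch0 mulr1.
by rewrite addnS !qpochS IHn exprD !mulrA.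
Qed.

(** Factor by factor, 1 - x^2 q^(2j) = (1 - x q^j)(1 + x q^j). *)
Lemma qpoch_sqr x q n :
  qpoch (x ^+ 2) (q ^+ 2) n = qpoch x q n * qpoch (- x) q n.
Proof.
elim: n => [|n IHn]; first by rewrite !qpoch0 mulr1.
by rewrite !qpochS IHn -exprM mulnC exprM; ring.
Qed.

End QPochhammer.

Section QBinomial.
Context {F : fieldType} (q : F).
Hypothesis q_generic : forall n, 1 - q ^+ n.+1 != 0.

Lemma qpoch_qq_neq0 n : qpoch q q n != 0.
Proof. by apply/prodf_neq0 => j _; rewrite -exprS. Qed.

Lemma qbinomn0 n : qbinom q n 0 = 1.
Proof. by rewrite /qbinom leq0n subn0 qpoch0 mul1r divff // qpoch_qq_neq0. Qed.

Lemma qbinomnn n : qbinom q n n = 1.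
Proof. by rewrite /qbinom leqnn subnn qpoch0 mulr1 divff // qpoch_qq_neq0. Qed.

Lemma qbinom_small n m : (n < m)%N -> qbinom q n m = 0.
Proof. by move=> lt_nm; rewrite /qbinom leqNgt lt_nm. Qed.

Lemma qbinomD m n :
  qbinom q (m + n) m = qpoch q q (m + n) / (qpoch q q m * qpoch q q n).
Proof. by rewrite /qbinom leq_addr addKn. Qed.

(** Over a common denominator, with d = n - k - 1, this is 1 - q^(n+1) = (1 - q^(d+1)) + q^(d+1) (1
    - q^(k+1)). The case k = n is apart, since [n,n+1] is 0 by convention and not a quotient. *)
Lemma qbinomS n k : (k <= n)%N ->
  qbinom q n.+1 k.+1 = qbinom q n k.+1 + q ^+ (n - k) * qbinom q n k.
Proof.
rewrite leq_eqVlt => /predU1P[->|/subnKC <-].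
  by rewrite !qbinomnn qbinom_small // subnn expr0 add0r mulr1.
move: (n - k.+1)%N => d.
rewrite -addnS !(qbinomD k.+1) (addSnnS k d) qbinomD addKn addSn !qpochS -!exprS.
rewrite -addSn !exprD; field.
by rewrite !qpoch_qq_neq0 !q_generic.
Qed.

(** Both sides equal (q;q)_(k+j+n) / ((q;q)_k (q;q)_j (q;q)_n). *)
Lemma qbinom_trinomial k j n :
  qbinom q (k + j + n) (k + j) * qbinom q (k + j) k
  = qbinom q (k + j + n) k * qbinom q (j + n) j.
Proof.
rewrite !qbinomD -addnA qbinomD; field.
by rewrite !qpoch_qq_neq0.
Qed.

Lemma qbinomial_theorem x n :
  qpoch (- x * q) q n = \sum_(k < n.+1) q ^+ triangular k * qbinom q n k * x ^+ k.
Proof.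
elim: n => [|n IHn]; first by rewrite qpoch0 big_ord1 qbinomn0 !mulr1.
rewrite qpochS mulrBr mulr1 {1}IHn.
(* A zero term is added at k = n + 1, so that once the terms k = 0 are split off, both sides run
   over the same range and compare termwise. *)
have -> : \sum_(k < n.+1) q ^+ triangular k * qbinom q n k * x ^+ k
        = \sum_(k < n.+2) q ^+ triangular k * qbinom q n k * x ^+ k.
  by rewrite [RHS]big_ord_recr /= (qbinom_small n n.+1) // mulr0 mul0r addr0.
rewrite big_ord_recl [RHS]big_ord_recl !qbinomn0 -addrA; congr (_ + _).
rewrite IHn mulr_suml -sumrB; apply: eq_bigr => i _; rewrite /= /bump !add1n.
have le_in : (i <= n)%N by rewrite -ltnS.
have -> : q ^+ n = q ^+ i * q ^+ (n - i) by rewrite -exprD subnKC.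
rewrite qbinomS // triangularS exprD !exprS; ring.
Qed.

(** A bound independent of n lets the double sum be exchanged below. *)
Lemma qbinomial_theorem_widen x n N : (n < N)%N ->
  qpoch (- x * q) q n = \sum_(k < N) q ^+ triangular k * qbinom q n k * x ^+ k.
Proof.
move=> lt_nN; rewrite qbinomial_theorem.
rewrite (big_ord_widen N (fun k => q ^+ triangular k * qbinom q n k * x ^+ k)) //.
rewrite [LHS]big_mkcond; apply: eq_bigr => k _; case: ltnP => // lt_nk.
by rewrite qbinom_small // mulr0 mul0r.
Qed.

Lemma sum_qbinom_mul k d :
  \sum_(i < (k + d).+1) q ^+ triangular i * qbinom q (k + d) i * qbinom q i k
  = q ^+ triangular k * qbinom q (k + d) k * qpoch (- q ^+ k * q) q d.
Proof.
(* The terms with i < k vanish; the others are i = k + j with j <= d. *)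
rewrite -addnS big_split_ord /= big1 ?add0r => [|i _]; last first.
  by rewrite (qbinom_small i k) // mulr0.
rewrite qbinomial_theorem mulr_sumr; apply: eq_bigr => j _ /=.
have le_jd : (j <= d)%N by rewrite -ltnS.
have := qbinom_trinomial k j (d - j).
rewrite -addnA subnKC // => trin.
rewrite -mulrA trin triangularD !exprD exprM; ring.
Qed.

Lemma sum_qpoch_qbinom c M : (forall n, 1 + q ^+ n.+1 != 0) ->
  \sum_(i < M.+1) q ^+ triangular i * qpoch (- c * q) q i * qbinom q M i
  = qpoch (- q) q M *
    \sum_(k < M.+1)
       c ^+ k * q ^+ (2 * triangular k) / qpoch (q ^+ 2) (q ^+ 2) k
       * qpoch (q ^+ (M - k + 1)) q k.
Proof.
move=> q_generic'.
under eq_bigr => i _ do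
  rewrite (qbinomial_theorem_widen c i M.+1) // mulr_sumr mulr_suml.
rewrite exchange_big mulr_sumr; apply: eq_bigr => k _ /=.
have le_kM : (k <= M)%N by rewrite -ltnS.
move: (nat_of_ord k) le_kM => {}k /subnKC <-; move: (M - k)%N => d.
transitivity (c ^+ k * q ^+ triangular k *
  \sum_(i < (k + d).+1) q ^+ triangular i * qbinom q (k + d) i * qbinom q i k).
  by rewrite mulr_sumr; apply: eq_bigr => i _; ring.
(* (-q;q)_(k+d) splits into (-q;q)_k, which cancels against (q^2;q^2)_k, and (-q^(k+1);q)_d.
   Likewise (q;q)_(d+k) = (q;q)_d (q^(d+1);q)_k. *)
rewrite sum_qbinom_mul qbinomD addKn qpoch_sqr [qpoch (- q) q (k + d)]qpochD.
rewrite (addnC k d) qpochD addn1 exprS mul2n -addnn exprD.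
rewrite !mulNr (mulrC (q ^+ k)).
field; rewrite !qpoch_qq_neq0 !andbT.
by apply/prodf_neq0 => j _; rewrite mulNr opprK -exprS.
Qed.

End QBinomial.

(** Degrees differ. The sign [(-1) ^+ b] covers 1 and -1 at once, for the nonvanishing of 1 -
    q^(n+1) and of 1 + q^(n+1). *)
Lemma polyX_exp_neq_sign n (b : bool) : ('X ^+ n.+1 : {poly int}) != (-1) ^+ b.
Proof.
apply/eqP => /(congr1 (fun p : {poly int} => size p)).
by case: b; rewrite size_polyXn ?expr1 ?size_polyN size_poly1.
Qed.

Lemma q_indet_exp_neq_sign n (b : bool) : q_indet ^+ n.+1 != (-1) ^+ b.
Proof.
rewrite /q_indet -(rmorph_sign (@tofrac _)) -rmorphXn tofrac_eq.
rewrite -(rmorph_sign (@polyC _)) -rmorphXn (inj_eq (@polyC_inj _)).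
exact: polyX_exp_neq_sign.
Qed.

Theorem theorem3p1 (M : nat) (hM : (0 < M)%N) :
  let q := q_indet in
  let c := c_indet in
  \sum_(i < M.+1)
     q ^+ triangular i * qpoch (- c * q) q i * qbinom q M i
  = qpoch (- q) q M *
    \sum_(k < M.+1)
       c ^+ k * q ^+ (2 * triangular k) / qpoch (q ^+ 2) (q ^+ 2) k
       * qpoch (q ^+ (M - k + 1)) q k.
Proof.
apply: sum_qpoch_qbinom => n.
  by rewrite subr_eq0 eq_sym (q_indet_exp_neq_sign n false).
by rewrite addrC addr_eq0 (q_indet_exp_neq_sign n true).
Qed.
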